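(* Fix one notion of independence among tensor, free, Boolean and monotone independence. Then joint cumulants satisfying (MK1), (MK2) and (MK3') (as defined in the context, relative to the fixed notion of independence) are unique: if $\{K_n^{(1)}\}_{n\ge1}$ and $\{K_n^{(2)}\}_{n\ge1}$ are two families of joint cumulants each satisfying (MK1), (MK2) and (MK3'), with possibly different polynomials in (MK2), then $K_n^{(1)}=K_n^{(2)}$ for every $n\ge1$.
   Context: An algebraic probability space $(\mathcal{A},\varphi)$ is a unital $*$-algebra $\mathcal{A}$ over $\mathbb{C}$ with a state $\varphi$. **Independence.** Let $\{\mathcal{A}_\lambda\}_{\lambda\in\Lambda}$ be $*$-subalgebras of $\mathcal{A}$. The rules below are required for all $n\ge2$ and all $X_i\in\mathcal{A}_{\lambda_i}$ ($1\le i\le n$) with $\lambda_i\ne\lambda_{i+1}$ for $1\le i\le n-1$. (1) Tensor: $\varphi(X_1\cdots X_n)=\prod_{\lambda\in\Lambda}\varphi\big(\overrightarrow{\prod}_{i;\,\lambda_i=\lambda}X_i\big)$, where $\overrightarrow{\prod}$ is the product in the same order as the factors appear in $X_1\cdots X_n$ (empty product $=1$). (2) Free (all $\mathcal{A}_\lambda$ are assumed to contain the unit of $\mathcal{A}$): $\varphi(X_1\cdots X_n)=0$ whenever $\varphi(X_1)=\cdots=\varphi(X_n)=0$. (3) Boolean: $\varphi(X_1\cdots X_n)=\varphi(X_1)\cdots\varphi(X_n)$. (4) Monotone ($\Lambda$ is linearly ordered by $<$): $\varphi(X_1\cdots X_i\cdots X_n)=\varphi(X_i)\varphi(X_1\cdots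 X_{i-1}X_{i+1}\cdots X_n)$ whenever $\lambda_{i-1}<\lambda_i$ and $\lambda_i>\lambda_{i+1}$ (one of the inequalities is dropped when $i=1$ or $i=n$). **Dot operation.** For the fixed notion of independence, take copies $\{X^{(j)}\}_{j\ge1}$ of every $X\in\mathcal{A}$ in an algebraic probability space $(\widetilde{\mathcal{A}},\widetilde\varphi)$ such that: $X\mapsto X^{(j)}$ is a $*$-homomorphism $\mathcal{A}\to\widetilde{\mathcal{A}}$ for each $j$; $\widetilde\varphi(X_1^{(j)}\cdots X_n^{(j)})=\varphi(X_1\cdots X_n)$ for all $X_i\in\mathcal{A}$, $j,n\ge1$; and the subalgebras $\mathcal{A}^{(j)}=\{X^{(j)}\}_{X\in\mathcal{A}}$, $j\ge1$ (index set with its natural order in the monotone case), are independent. Such copies always exist. Put $N.X=X^{(1)}+\cdots+X^{(N)}$ for integers $N\ge0$, with $0.X=0$. One writes $\varphi$ for $\widetilde\varphi$. **Joint cumulants.** A family of joint cumulants $\{K_n\}_{n\ge1}$ assigns to every algebraic probability space $(\mathcal{A},\varphi)$ functionals $K_n:\mathcal{A}^n\to\mathbb{C}$, $n\ge1$. The conditions are: (MK1) Multilinearity: $K_n:\mathcal{A}^n\to\mathbb{C}$ is multilinear. (MK2) Polynomiality: for each $n$ there is a polynomial $P_n$ (depending only on $n$, not on the space or the variables) such that $$K_n(X_1,\dots,X_n)=\varphi(X_1\cdots X_n)+P_n\big(\{\varphi(X_{i_1}\cdots X_{i_p})\}_{1\le p\le n-1,\ i_1<\cdots<i_p}\big).$$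 (MK3') Extensivity: $K_n(N.X_1,\dots,N.X_n)=N K_n(X_1,\dots,X_n)$ for all integers $N\ge 0$, where the left side is evaluated in $(\widetilde{\mathcal{A}},\widetilde\varphi)$. *)

(* Defs.v *)
From HB Require Import structures.
From mathcomp Require Import all_boot all_order all_algebra.
From mathcomp Require Import complex mpoly reals.

Set Implicit Arguments.
Unset Strict Implicit.
Unset Printing Implicit Defensive.

Import Order.TTheory GRing.Theory Num.Theory.
Local Open Scope ring_scope.

(* [algType] already includes [1 != 0]; this excludes nothing here, since an
   algebra carrying a functional with [phi 1 = 1] is nontrivial. *)
HB.mixin Record Algebra_hasStar (C : numClosedFieldType) A
    of GRing.Algebra C A := {
  star : A -> A;
  starD : {morph star : x y / x + y};
  starZ : forall (c : C) (x : A), star (c *: x) = c^* *: star x;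
  starM : forall x y : A, star (x * y) = star y * star x;
  starK : involutive star
}.

#[short(type="starAlgType")]
HB.structure Definition StarAlgebra (C : numClosedFieldType) :=
  { A of Algebra_hasStar C A & GRing.Algebra C A }.

(* In [R[i]], [0 <= z] means that [z] is real and nonnegative. *)
Record algProbSpace (R : realType) := AlgProbSpace {
  aps_alg :> starAlgType R[i];
  state : {scalar aps_alg};
  state1 : state 1 = 1;
  state_ge0 : forall x : aps_alg, 0 <= state (star x * x)
}.

Arguments state {R} A : rename.

(* Neither *-subalgebras nor *-homomorphisms are required to respect units. *)
Record starSubalg (C : numClosedFieldType) (A : starAlgType C) := StarSubalg {
  subalg_set :> A -> Prop;
  subalg0 : subalg_set 0;
  subalgD : forall x y, subalg_set x -> subalg_set y -> subalg_set (x + y);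
  subalgZ : forall (c : C) x, subalg_set x -> subalg_set (c *: x);
  subalgM : forall x y, subalg_set x -> subalg_set y -> subalg_set (x * y);
  subalg_star : forall x, subalg_set x -> subalg_set (star x)
}.

Record starHom (C : numClosedFieldType) (A B : starAlgType C) := StarHom {
  hom_fun :> {linear A -> B};
  homM : {morph hom_fun : x y / x * y};
  hom_star : {morph hom_fun : x / star x}
}.

Section Range.
Variables (C : numClosedFieldType) (A B : starAlgType C) (f : starHom A B).

Definition hom_range (y : B) : Prop := exists x : A, y = f x.

Fact hom_range0 : hom_range 0.
Proof. by exists 0; rewrite linear0. Qed.

Fact hom_rangeD x y : hom_range x -> hom_range y -> hom_range (x + y).
Proof. by move=> [a ->] [b ->]; exists (a + b); rewrite linearD. Qed.

Fact hom_rangeZ (c : C) x : hom_range x -> hom_range (c *: x).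
Proof. by move=> [a ->]; exists (c *: a); rewrite linearZ. Qed.

Fact hom_rangeM x y : hom_range x -> hom_range y -> hom_range (x * y).
Proof. by move=> [a ->] [b ->]; exists (a * b); rewrite homM. Qed.

Fact hom_range_star x : hom_range x -> hom_range (star x).
Proof. by move=> [a ->]; exists (star a); rewrite hom_star. Qed.

Definition hom_range_subalg : starSubalg B :=
  StarSubalg hom_range0 hom_rangeD hom_rangeZ hom_rangeM hom_range_star.

End Range.

Inductive independence := Tensor | Free | Boolean | Monotone.

Section Independence.
Variables (R : realType) (A : algProbSpace R).
Variables (d : Order.disp_t) (L : orderType d).
Local Notation phi := (state A).

(* [\prod_(i < n)] and its filtered variants multiply in increasing order of
   the index. *)

(* Indices that do not occur in [lam] contribute [phi 1 = 1] to the product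
   over all of [L], hence the restriction to those that do. *)
Definition tensor_rule n (lam : 'I_n -> L) (X : 'I_n -> A) : Prop :=
  phi (\prod_(i < n) X i) =
  \prod_(l <- undup [seq lam i | i <- enum 'I_n])
     phi (\prod_(i < n | lam i == l) X i).

Definition free_rule n (X : 'I_n -> A) : Prop :=
  (forall i, phi (X i) = 0) -> phi (\prod_(i < n) X i) = 0.

Definition boolean_rule n (X : 'I_n -> A) : Prop :=
  phi (\prod_(i < n) X i) = \prod_(i < n) phi (X i).

(* At an endpoint one of the two conditions is vacuous. *)
Definition monotone_rule n (lam : 'I_n -> L) (X : 'I_n -> A) : Prop :=
  forall i : 'I_n,
    (forall j : 'I_n, j.+1 = i :> nat -> (lam j < lam i)%O) ->
    (forall j : 'I_n, j = i.+1 :> nat -> (lam j < lam i)%O) ->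
    phi (\prod_(j < n) X j) = phi (X i) * phi (\prod_(j < n | j != i) X j).

(* The order on [L] is used only in the monotone case. *)
Definition independent (k : independence) (S : L -> starSubalg A) : Prop :=
  (k = Free -> forall l, S l 1) /\
  forall n (lam : 'I_n -> L) (X : 'I_n -> A),
    (2 <= n)%N ->
    (forall i, S (lam i) (X i)) ->
    (forall i j : 'I_n, j = i.+1 :> nat -> lam i != lam j) ->
    match k with
    | Tensor => tensor_rule lam X
    | Free => free_rule X
    | Boolean => boolean_rule X
    | Monotone => monotone_rule lam X
    end.

End Independence.

(* [cp_map j] is X |-> X^(j+1): copies are numbered from 0. *)
Record copies (R : realType) (k : independence) (A : algProbSpace R) := Copies {
  cp_space : algProbSpace R;
  cp_map : nat -> starHom A cp_space;
  cp_moment : forall (j n : nat) (X : 'I_n -> A), (0 < n)%N ->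
    state cp_space (\prod_(i < n) cp_map j (X i)) = state A (\prod_(i < n) X i);
  cp_independent : independent k (fun j : nat => hom_range_subalg (cp_map j))
}.

Definition dot (R : realType) (k : independence) (A : algProbSpace R)
    (c : copies k A) (N : nat) (X : A) : cp_space c :=
  \sum_(j < N) cp_map c j X.

(* [K A n] is K_n on the space A; its value at [n = 0] is irrelevant. *)
Definition functionals (R : realType) :=
  forall (A : algProbSpace R) (n : nat), ('I_n -> A) -> R[i].

Definition subst_at n (T : Type) (X : 'I_n -> T) (i : 'I_n) (x : T) : 'I_n -> T :=
  fun j => if j == i then x else X j.

Definition MK1 (R : realType) (K : functionals R) : Prop :=
  forall (A : algProbSpace R) (n : nat), (0 < n)%N ->
  forall (X : 'I_n -> A) (i : 'I_n), scalar (fun x => K A n (subst_at X i x)).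

(* A subset {i_1 < ... < i_p} stands for the variable phi(X_{i_1}...X_{i_p}). *)
Definition proper_subsets (n : nat) : {set {set 'I_n}} :=
  [set S : {set 'I_n} | (1 <= #|S| <= n.-1)%N].

Definition lower_moments (R : realType) (A : algProbSpace R) n (X : 'I_n -> A) :
    'I_#|proper_subsets n| -> R[i] :=
  fun m => state A (\prod_(i in enum_val m) X i).

Definition MK2 (R : realType) (K : functionals R) : Prop :=
  forall n : nat, (0 < n)%N ->
  exists P : {mpoly R[i][#|proper_subsets n|]},
  forall (A : algProbSpace R) (X : 'I_n -> A),
    K A n X = state A (\prod_(i < n) X i) + P.@[lower_moments X].

Definition MK3' (R : realType) (k : independence)
    (cp : forall A : algProbSpace R, copies k A) (K : functionals R) : Prop :=
  forall (A : algProbSpace R) (n N : nat), (0 < n)%N ->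
  forall X : 'I_n -> A,
    K (cp_space (cp A)) n (fun i => dot (cp A) N (X i)) = N%:R * K A n X.

Definition joint_cumulants (R : realType) (k : independence)
    (cp : forall A : algProbSpace R, copies k A) (K : functionals R) : Prop :=
  [/\ MK1 K, MK2 K & MK3' cp K].

(* Main.v *)
(** Induction on [n] through (MK2) and (MK3') shows that, for each nonempty [S],
    the moment of [(N.X_i)_(i in S)] is a polynomial in [N]; it vanishes at
    [N = 0], so it equals [N r_S(N)].  The difference [D = K1_n - K2_n] equals
    [Q(lower moments)] for one polynomial [Q], is homogeneous of degree [n] and
    extensive.  Hence for every integer [z > 0]
      [D(X) = D(z^-1 (z^n . X)) = Q ((z^(n - |S|) r_S(z^n))_S)],
    so this is an identity of polynomials in [z].  As [|S| < n], setting [z = 0]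
    gives [D(X) = Q(0) = D(0) = 0]. *)

Require Import Defs.
From mathcomp Require Import all_boot all_order all_algebra.
From mathcomp Require Import reals.
From mathcomp Require Import complex mpoly boolp.

Set Implicit Arguments.
Unset Strict Implicit.
Unset Printing Implicit Defensive.

Import GRing.Theory Num.Theory.
Local Open Scope ring_scope.

Lemma meval_poly (C : comNzRingType) k (P : {mpoly C[k]}) (h : 'I_k -> {poly C}) :
  exists q : {poly C}, forall x, q.[x] = P.@[fun i => (h i).[x]].
Proof.
exists (\sum_(m <- msupp P) (P@_m)%:P * \prod_i h i ^+ m i) => x.
rewrite mevalE horner_sum; apply: eq_bigr => m _.
rewrite hornerM hornerC horner_prod; congr (_ * _).
by apply: eq_bigr => i _; rewrite horner_exp.
Qed.

(** A nonzero [p - c%:P] would have as many distinct roots as its [size], one more than its degree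
    allows. *)
Lemma poly_const_on_posnat (C : numDomainType) (p : {poly C}) (c : C) :
  (forall k, p.[k.+1%:R] = c) -> p = c%:P.
Proof.
move=> pc; apply/eqP; rewrite -subr_eq0; apply/negPn/negP => nz.
pose rs : seq C := [seq k.+1%:R | k <- iota 0 (size (p - c%:P))].
have rs_root : all (root (p - c%:P)) rs.
  apply/allP => _ /mapP[k _ ->].
  by rewrite /root hornerD hornerN hornerC pc subrr.
have rs_uniq : uniq rs.
  rewrite map_inj_uniq ?iota_uniq // => a b /eqP.
  by rewrite eqr_nat => /eqP[].
by have := max_poly_roots nz rs_root rs_uniq; rewrite size_map size_iota ltnn.
Qed.

(** [enum_val] lists [S] in increasing order, so the noncommutative product keeps its order. A
    moment over [S] thus becomes the full moment of a family of length [#|S|], the form that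
    induction needs. *)
Lemma prod_enum_val (B : nzRingType) n (S : {set 'I_n}) (F : 'I_n -> B) :
  \prod_(i in S) F i = \prod_(j < #|S|) F (enum_val j).
Proof.
(* [big_nth] needs a default index, and [ord0] exists only in ['I_n.+1]. *)
case: n => [|n] in S F *.
  rewrite [LHS]big_pred0; last by case.
  by rewrite [RHS]big1 // => j; case: (enum_val j).
rewrite -big_filter deprecated_filter_index_enum (big_nth ord0) -cardE big_mkord.
by apply: eq_bigr => j _; rewrite -enum_val_nth.
Qed.

Lemma prod_ord_eq0 (B : pzRingType) n (F : 'I_n -> B) : (0 < n)%N ->
  (forall i, F i = 0) -> \prod_(i < n) F i = 0.
Proof. by case: n F => // n F _ F0; rewrite big_ord_recl F0 mul0r. Qed.

Lemma proper_subset_size n (s : 'I_#|proper_subsets n|) :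
  (0 < #|enum_val s| < n)%N.
Proof.
have := enum_valP s; rewrite inE => /andP[S0 Sn]; rewrite S0 /=.
by apply: leq_ltn_trans Sn _; rewrite ltn_predL (leq_trans S0) // -[leqRHS]card_ord max_card.
Qed.

Section JointCumulants.
Variables (R : realType) (k : independence).
Variable cp : forall A : algProbSpace R, copies k A.
Local Notation C := R[i].

(** The scalar is pulled out one slot at a time: [Y m] has its first [m] entries scaled. *)
Lemma functional_scale (K : functionals R) (A : algProbSpace R) n
    (c : C) (X : 'I_n -> A) : MK1 K -> (0 < n)%N ->
  K A n (fun i => c *: X i) = c ^+ n * K A n X.
Proof.
move=> lin n0; pose Y m (i : 'I_n) := if (i < m)%N then c *: X i else X i.
have -> : (fun i => c *: X i) = Y n by apply/funext => i; rewrite /Y ltn_ord.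
suff H m : (m <= n)%N -> K A n (Y m) = c ^+ m * K A n X by exact: H.
elim: m => [|m IH] le_mn.
  by rewrite mul1r; congr (K A n _); apply/funext.
pose i := Ordinal le_mn; have linK := lin A n n0 (Y m) i.
(* The summand [0] gives the slot the shape required by [scalar]; its contribution vanishes by
   [K0]. *)
have -> : Y m.+1 = subst_at (Y m) i (c *: X i + 0).
  apply/funext => j; rewrite /subst_at /Y addr0 ltnS leq_eqVlt -[(j : nat) == m]/(j == i).
  by case: eqVneq => [->|].
have K0 : K A n (subst_at (Y m) i 0) = 0.
  have := linK 1 0 0; rewrite scaler0 addr0 mul1r => /eqP.
  by rewrite eq_sym -subr_eq0 addrK => /eqP.
rewrite linK K0 addr0 exprS -mulrA -(IH (ltnW le_mn)); congr (c * K A n _).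
apply/funext => j; rewrite /subst_at /Y.
by case: eqVneq => // ->; rewrite /= ltnn.
Qed.

Lemma dot0 (A : algProbSpace R) (x : A) : dot (cp A) 0 x = 0.
Proof. exact: big_ord0. Qed.

(** (MK2) is solved for the top moment: by (MK3') the cumulant is linear in [N], and the lower
    moments are polynomial in [N] by strong induction. *)
Lemma moment_dot_poly (K : functionals R) (A : algProbSpace R) :
    joint_cumulants cp K -> forall n (X : 'I_n -> A), (0 < n)%N ->
  exists p : {poly C}, forall N : nat,
    state _ (\prod_(i < n) dot (cp A) N (X i)) = p.[N%:R].
Proof.
move=> [_ poly ext] n; have [m] := ubnP n; elim: m n => // m IH n le_nm X n0.
have [P KE] := poly n n0.
have /fin_all_exists[h hE] (s : 'I_#|proper_subsets n|) : exists p : {poly C},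
    forall N : nat,
    lower_moments (fun i => dot (cp A) N (X i)) s = p.[N%:R].
  have /andP[S0 Sn] := proper_subset_size s.
  have Sm : (#|enum_val s| < m)%N by apply: leq_trans Sn _.
  have [p pE] := IH _ Sm (X \o enum_val) S0.
  by exists p => N; rewrite -pE /lower_moments prod_enum_val.
have [q qE] := meval_poly P h.
exists ((K A n X)%:P * 'X - q) => N.
rewrite hornerD hornerN hornerM hornerC hornerX qE mulrC -ext // KE.
by rewrite (meval_eq _ (hE^~ N)) addrK.
Qed.

Lemma lower_moments_scale (A : algProbSpace R) n (c : C) (X : 'I_n -> A) s :
  lower_moments (fun i => c *: X i) s = c ^+ #|enum_val s| * lower_moments X s.
Proof.
rewrite /lower_moments !prod_enum_val -linearZ scaler_prod /=.
by rewrite prodr_const card_ord.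
Qed.

End JointCumulants.

(* [cp] is the choice of copies on which the dot operation is based. *)
Theorem theorem3p1 (R : realType) (k : independence)
    (cp : forall A : algProbSpace R, copies k A) (K1 K2 : functionals R) :
  joint_cumulants cp K1 -> joint_cumulants cp K2 ->
  forall n : nat, (0 < n)%N ->
  forall (A : algProbSpace R) (X : 'I_n -> A), K1 A n X = K2 A n X.
Proof.
move=> JK1 JK2 n n0 A X.
have [lin1 poly1 ext1] := JK1; have [lin2 poly2 ext2] := JK2.
have [P1 K1E] := poly1 n n0; have [P2 K2E] := poly2 n n0.
pose D (B : algProbSpace R) (Y : 'I_n -> B) := K1 B n Y - K2 B n Y.
(* The top moment has coefficient 1 in both instances of (MK2), so it cancels. *)
have DE B Y : D B Y = (P1 - P2).@[lower_moments Y].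
  by rewrite /D K1E K2E mevalB opprD addrACA subrr add0r.
have D_scale (B : algProbSpace R) (c : R[i]) (Y : 'I_n -> B) : D B (fun i => c *: Y i) = c ^+ n * D B Y.
  by rewrite /D !functional_scale // mulrBr.
have D_dot N : D _ (fun i => dot (cp A) N (X i)) = N%:R * D A X.
  by rewrite /D ext1 // ext2 // mulrBr.
have /fin_all_exists[r rE] (s : 'I_#|proper_subsets n|) : exists r : {poly R[i]},
    forall N : nat,
    lower_moments (fun i => dot (cp A) N (X i)) s = r.[N%:R] * N%:R.
  have /andP[S0 _] := proper_subset_size s.
  have [p pE] := moment_dot_poly JK1 (X \o enum_val) S0.
  (* At [N = 0] all dots are zero and the product is nonempty, so a factor ['X] splits off [p]. *)
  have /factor_theorem[r pr] : root p 0.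
    by rewrite /root -(pE 0%N) prod_ord_eq0 ?linear0 // => i; apply: dot0.
  exists r => N; rewrite /lower_moments prod_enum_val pE pr.
  by rewrite hornerM subr0 hornerX.
(* With [N = z^n], the factor [N] from [rE] and the scaling by [z^-1] combine to [z^(n - |S|)], a
   true power since [|S| < n]. *)
have [q qE] := meval_poly (P1 - P2)
  (fun s => (r s \Po 'X^n) * 'X^(n - #|enum_val s|)).
have q_const : q = (D A X)%:P.
  apply: poly_const_on_posnat => z; set x : R[i] := z.+1%:R.
  have x0 : x != 0 by rewrite pnatr_eq0.
  rewrite qE; have -> : D A X = D _ (fun i => x^-1 *: dot (cp A) (z.+1 ^ n) (X i)).
    by rewrite D_scale D_dot natrX mulrA -exprMn mulVf // expr1n mul1r.
  rewrite DE; apply: meval_eq => s; rewrite lower_moments_scale rE natrX.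
  have /andP[_ /ltnW Sn] := proper_subset_size s.
  rewrite hornerM horner_comp !hornerXn mulrCA exprVn; congr (_ * _).
  by rewrite -/x expfB_cond ?(negPf x0) // mulrC.
have D0 : D A (fun=> 0) = 0.
  have := D_scale A 0 (fun=> 0); rewrite expr0n -[_ == _]negbK -lt0n n0 mul0r.
  by under [X in D A X]eq_fun do rewrite scaler0.
(* At 0 all arguments of [P1 - P2] vanish, the exponents [n - |S|] being positive; so do the lower
   moments of the zero family, each [S] being nonempty. *)
apply/subr0_eq; rewrite -/(D A X) -(hornerC (D A X) 0) -q_const qE -[RHS]D0 DE.
apply: meval_eq => s.
have /andP[S0 Sn] := proper_subset_size s.
rewrite hornerM hornerXn expr0n subn_eq0 leqNgt Sn mulr0.
by rewrite /lower_moments prod_enum_val prod_ord_eq0 ?linear0.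
Qed.
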